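(* Let $\mathcal V\subseteq\mathcal U$ be open and let $Y$ be a homogeneous polynomial vertical vector field of degree $r$ defined on $\mathcal V\times\mathbb C^n$. Then $Y$ is a symmetry of the system $\frac{dy}{dx}=A(x)y$ if and only if, as a map from $\mathcal V$ to $\mathfrak X^r[\mathbb C^n]$, it is a solution of the Lie--Vessiot system induced in the representation $(\Phi_r,\mathfrak X^r[\mathbb C^n])$. In other words, $Y\in\mathbf{sym}_X(\mathcal V)$ if and only if $$\frac{dY}{dx}=\Phi_r'(A(x))\,Y.$$
   Context: Let $\mathcal U$ be a nonempty connected open subset of $\mathbb{CP}_1$ with affine coordinate $x$. A function field $\mathcal K$ is a subfield of the field of meromorphic functions on $\mathcal U$ that contains the constants $\mathbb C$ and is closed under $\frac{d}{dx}$; fix one. Fix $n\ge 1$ and $A(x)=(a_{ij}(x))\in\mathfrak{gl}(n,\mathcal K)$, and consider the linear system $\frac{dy}{dx}=A(x)y$, $y=(y_1,\ldots,y_n)$, with associated meromorphic vector field on $\mathcal U\times\mathbb C^n$ $$X=\frac{\partial}{\partial x}+\sum_{i,j=1}^n a_{ij}(x)y_j\frac{\partial}{\partial y_i}.$$ For $\mathcal V\subseteq\mathcal U$ open, $\mathbf{sym}_X(\mathcal V)$ is the set of analytic vector fields $Y$ on $\mathcal V\times\mathbb C^n$ with $[Y,X]=0$ and $Yx=0$; its elements are called symmetries (of $X$, or of the system). A homogeneous polynomial vertical vector field of degree $r$ on $\mathcal V\times\mathbb C^n$ is an analytic vector field $\sum_i P_i(x,y)\frac{\partial}{\partial y_i}$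 whose components $P_i$ are homogeneous polynomials of degree $r$ in $y_1,\ldots,y_n$. $\mathfrak X^r[\mathbb C^n]$ is the finite-dimensional complex vector space of vector fields $\sum_{i=1}^n P_i(y)\frac{\partial}{\partial y_i}$ on $\mathbb C^n$ with all $P_i\in\mathbb C[y_1,\ldots,y_n]$ homogeneous of degree $r$. A homogeneous polynomial vertical vector field $Y$ of degree $r$ on $\mathcal V\times\mathbb C^n$ is viewed as the map $\mathcal V\to\mathfrak X^r[\mathbb C^n]$ sending $x_0$ to the restriction $Y(x_0)$ of $Y$ to the fibre $\{x_0\}\times\mathbb C^n$. The representation $\Phi_r:\mathrm{GL}(n,\mathbb C)\to\mathrm{GL}(\mathfrak X^r[\mathbb C^n])$ is $\Phi_r(M)(Z)=M_*(Z)$, where $M_*(Z)(p)=M\,Z(M^{-1}p)$ is the push-forward by the linear map $M$; $\Phi_r':\mathfrak{gl}(n,\mathbb C)\to\mathrm{End}(\mathfrak X^r[\mathbb C^n])$ is its differential at the identity, $\Phi'_r(M)(Z)=\frac{d}{d\varepsilon}\big|_{\varepsilon=0}\Phi_r(e^{\varepsilon M})(Z)$. For a finite-dimensional linear representation $(E,\Psi)$ of $\mathrm{GL}(n,\mathbb C)$ with differential $\Psi'$, the induced Lie--Vessiot system is the linear system $\frac{dv}{dx}=\Psi'(A(x))(v)$ on $\mathcal U\times E$. *)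

(* Defs.v *)
From HB Require Import structures.
From mathcomp Require Import all_boot all_order all_algebra.
From mathcomp Require Import all_classical all_reals all_analysis.
From mathcomp Require Import complex.
From mathcomp Require mpoly.
(* The notations of multinomials clash with those of MathComp-Analysis. *)
Import -(notations) mpoly.

Set Implicit Arguments.
Unset Strict Implicit.
Unset Printing Implicit Defensive.

Import Order.TTheory GRing.Theory Num.Theory.
Import numFieldNormedType.Exports.

Local Open Scope classical_set_scope.
Local Open Scope ring_scope.

(* Typing R[i] as a numeric field gives access to its topology, to its normed
   module structure and to complex differentiation. *)
Definition Cplx (R : realType) : numClosedFieldType := R[i].

(* The Riemann sphere: [Some x] is the point of affine coordinate x and [None]
   is the point at infinity. *)
Definition CP1 (R : realType) : topologicalType :=
  one_point_compactification (Cplx R).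

Section RiemannSphere.
Context {R : realType}.
Local Notation C := (Cplx R).
Local Notation CP1 := (CP1 R).

(* The two standard charts, with coordinates x and z = 1/x. *)
Variant chart_index := Affine | Infinity.

Definition chart (b : chart_index) (t : C) : CP1 :=
  match b with
  | Affine => Some t
  | Infinity => if t == 0 then None else Some t^-1
  end.

(* The global vector field d/dx reads (speed b t) d/dt in the chart b: it is
   - z^2 d/dz at infinity. *)
Definition speed (b : chart_index) (t : C) : C :=
  match b with Affine => 1 | Infinity => - t ^+ 2 end.

Definition affine (p : CP1) : C := if p is Some x then x else 0.

(* Complex analyticity is complex differentiability on an open set. *)
Definition analytic_at (g : C -> C) (a : C) : Prop :=
  \forall t \near a, derivable g t 1.

(* A meromorphic function is encoded by its values in CP1, the value at a pole
   being infinity ([None]), so that it is determined as a function. *)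
Definition regular_at (f : C -> CP1) (a : C) : Prop :=
  exists2 g : C -> C, analytic_at g a & \forall t \near a, f t = Some (g t).

Definition pole_at (f : C -> CP1) (a : C) : Prop :=
  f a = None /\
  exists (k : nat) (g : C -> C), [/\ (0 < k)%N, analytic_at g a, g a != 0 &
    \forall t \near a^', f t = Some (g t / (t - a) ^+ k)].

Definition meromorphic (U : set CP1) (f : CP1 -> CP1) : Prop :=
  forall b t, U (chart b t) ->
    regular_at (f \o chart b) t \/ pole_at (f \o chart b) t.

(* A function field on U. Functions are total on CP1, but only their values on
   U are constrained. The sum, product, inverse and derivative are prescribed
   only where they can be computed pointwise; this determines the meromorphic
   function h on U, the excluded points being isolated in U. *)
Record function_field (U : set CP1) (K : set (CP1 -> CP1)) : Prop := {
  function_field_meromorphic : forall f, K f -> meromorphic U f;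
  function_field_const : forall c : C,
    exists2 h, K h & forall p, U p -> h p = Some c;
  function_field_add : forall f g, K f -> K g ->
    exists2 h, K h & forall p x y, U p ->
      f p = Some x -> g p = Some y -> h p = Some (x + y);
  function_field_mul : forall f g, K f -> K g ->
    exists2 h, K h & forall p x y, U p ->
      f p = Some x -> g p = Some y -> h p = Some (x * y);
  function_field_inv : forall f, K f ->
    (exists2 p, U p & f p <> Some 0) ->
    exists2 h, K h & forall p x, U p ->
      f p = Some x -> x != 0 -> h p = Some x^-1;
  function_field_deriv : forall f, K f ->
    exists2 h, K h & forall b t, U (chart b t) -> f (chart b t) <> None ->
      h (chart b t) = Some (speed b t * derive1 (affine \o f \o chart b) t)
}.

End RiemannSphere.

Section VectorFields.
Context {R : realType} {n : nat}.
Local Notation C := (Cplx R).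
Local Notation CP1 := (CP1 R).

(* A vector field on (an open subset of) CP1 x C^n. The first component of a
   tangent vector is its coordinate along d/dx at affine points and along d/dz
   (z = 1/x) at infinity. *)
Definition vfield := CP1 * 'cV[C]_n -> C * 'cV[C]_n.

(* The components of Y in the coordinates (t, y), where t is the coordinate of
   the chart b: away from z = 0, d/dx = - z^2 d/dz. *)
Definition in_chart (b : chart_index) (Y : vfield) (q : C * 'cV[C]_n) :
    C * 'cV[C]_n :=
  let v := Y (chart b q.1, q.2) in
  match b with
  | Affine => v
  | Infinity => (if q.1 == 0 then v.1 else - q.1 ^+ 2 * v.1, v.2)
  end.

Definition analytic_vfield (V : set CP1) (Y : vfield) : Prop :=
  forall b (q : C * 'cV[C]_n), V (chart b q.1) ->
    differentiable (in_chart b Y) q.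

(* [Y, X]^k = Y(X^k) - X(Y^k) in the coordinates (t, y) of the chart b. *)
Definition bracket (b : chart_index) (Y X : vfield) (q : C * 'cV[C]_n) :
    C * 'cV[C]_n :=
  'D_(in_chart b Y q) (in_chart b X) q - 'D_(in_chart b X q) (in_chart b Y) q.

Definition regular_point (A : 'M[CP1 -> CP1]_n) (p : CP1) : Prop :=
  forall i j, A i j p <> None.

Definition mx_at (A : 'M[CP1 -> CP1]_n) (p : CP1) : 'M[C]_n :=
  \matrix_(i, j) affine (A i j p).

(* X = d/dx + sum_ij a_ij(x) y_j d/dy_i; as a vector field on CP1, d/dx vanishes
   at infinity. The values of X are meaningful at regular points of A only. *)
Definition system_vfield (A : 'M[CP1 -> CP1]_n) : vfield :=
  fun q => (if q.1 is Some _ then 1 else 0, mx_at A q.1 *m q.2).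

(* The symmetries sym_X(V) of the linear system dy/dx = A(x) y. The meromorphic
   vector field [Y, X] is zero when it vanishes wherever X is regular. *)
Definition sym (A : 'M[CP1 -> CP1]_n) (V : set CP1) : set vfield :=
  [set Y | [/\ analytic_vfield V Y,
    forall p y, V p -> (Y (p, y)).1 = 0 &
    forall b (q : C * 'cV[C]_n),
      V (chart b q.1) -> regular_point A (chart b q.1) ->
      bracket b Y (system_vfield A) q = 0]].

End VectorFields.

Arguments vfield R n : clear implicits.

Section LieVessiot.
Context {R : realType} {n : nat} {E : vectType (Cplx R)}.
Local Notation C := (Cplx R).
Local Notation CP1 := (CP1 R).

Definition expmx m (M : 'M[C]_m) : 'M[C]_m :=
  limn (series (fun k => (k`!%:R)^-1 *: M ^+ k)).

(* Derivatives of maps into the finite-dimensional space E are taken in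
   coordinates. *)
Definition vderivable (v : C -> E) (t : C) : Prop :=
  forall i, derivable (fun s => coord (vbasis fullv) i (v s)) t 1.

Definition vderive (v : C -> E) (t : C) : E :=
  \sum_i derive1 (fun s => coord (vbasis fullv) i (v s)) t *: (vbasis fullv)`_i.

(* The differential at the identity of a representation Psi of GL(n, C): only
   the values of Psi at invertible matrices are used. *)
Definition rep_diff (Psi : 'M[C]_n -> E -> E) (M : 'M[C]_n) (v : E) : E :=
  vderive (fun eps : C => Psi (expmx (eps *: M)) v) 0.

(* dv/dx at the point of coordinate t of the chart b *)
Definition ddx (v : CP1 -> E) (b : chart_index) (t : C) : E :=
  speed b t *: vderive (v \o chart b) t.

(* dv/dx = Psi'(A(x)) v, as an equality of meromorphic maps on V *)
Definition lie_vessiot_eq (Psi : 'M[C]_n -> E -> E) (A : 'M[CP1 -> CP1]_n)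
    (V : set CP1) (v : CP1 -> E) : Prop :=
  forall b t, V (chart b t) -> regular_point A (chart b t) ->
    ddx v b t = rep_diff Psi (mx_at A (chart b t)) (v (chart b t)).

Definition lie_vessiot_solution (Psi : 'M[C]_n -> E -> E)
    (A : 'M[CP1 -> CP1]_n) (V : set CP1) (v : CP1 -> E) : Prop :=
  (forall b t, V (chart b t) -> vderivable (v \o chart b) t) /\
  lie_vessiot_eq Psi A V v.

End LieVessiot.

(* X^r[C^n] for n = m.+1: the family of the components P_i. *)
Definition homog_vfield (R : realType) (m r : nat) : vectType (Cplx R) :=
  {ffun 'I_m.+1 -> dhomog m.+1 (Cplx R) r}.

Section Representation.
Context {R : realType} {m r : nat}.
Local Notation C := (Cplx R).
Local Notation CP1 := (CP1 R).
Local Notation n := m.+1.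

Definition homog_eval (Z : homog_vfield R m r) (y : 'cV[C]_n) : 'cV[C]_n :=
  \col_i meval (fun j => y j 0) (Z i).

Definition lin_forms (N : 'M[C]_n) : n.-tuple (mpoly n C) :=
  [tuple \sum_l N k l *: mpolyX C (mnm1 l) | k < n].

Definition push_component (M : 'M[C]_n) (Z : homog_vfield R m r) (i : 'I_n) :
    mpoly n C :=
  \sum_j M i j *: comp_mpoly (lin_forms (invmx M)) (Z j).

Lemma lin_forms_homog N k : tnth (lin_forms N) k \is ishomog1 1 (@mdeg n).
Proof.
rewrite tnth_mktuple; apply: rpred_sum => l _; apply: rpredZ.
by rewrite dhomogX /= mdeg1.
Qed.

Lemma push_component_homog M Z i :
  push_component M Z i \is ishomog1 r (@mdeg n).
Proof.
apply: rpred_sum => j _; apply: rpredZ.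
rewrite /comp_mpoly /mmap big_seq; apply: rpred_sum => mon Hmon.
rewrite mul_mpolyC; apply: rpredZ.
have <- : mdeg mon = r by exact: (dhomogP _ _ _ (dhomog_is_dhomog (Z j))).
rewrite mdegE /mmap1.
apply: (big_ind2 (fun p d => p \is ishomog1 d (@mdeg n))).
- exact: dhomog1.
- by move=> p d q e; exact: dhomogM.
- move=> k _; rewrite -[X in ishomog1 X]mul1n.
  exact/dhomogMn/lin_forms_homog.
Qed.

(* Phi_r(M) Z, the push-forward M_* Z *)
Definition Phi (M : 'M[C]_n) (Z : homog_vfield R m r) : homog_vfield R m r :=
  [ffun i => DHomog (push_component_homog M Z i)].

Lemma homog_eval_Phi M Z p :
  homog_eval (Phi M Z) p = M *m homog_eval Z (invmx M *m p).
Proof.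
apply/colP => i; rewrite !mxE ffunE /= /push_component raddf_sum /=.
apply: eq_bigr => j _; rewrite mevalZ comp_mpoly_meval !mxE; congr (_ * _).
apply: meval_eq => k; rewrite tnth_mktuple raddf_sum /= mxE.
by apply: eq_bigr => l _; rewrite mevalZ mevalXU.
Qed.

(* Homogeneous polynomial vertical vector fields of degree r on V x C^n *)
Definition homog_poly_vfield (V : set CP1) (Y : vfield R n) : Prop :=
  analytic_vfield V Y /\
  forall p, V p -> exists Z : homog_vfield R m r,
    forall y, Y (p, y) = (0, homog_eval Z y).

(* The map p |-> Y(p), the restriction of Y to the fibre over p *)
Definition fibre (Y : vfield R n) (p : CP1) : homog_vfield R m r :=
  xget 0 [set Z | forall y, Y (p, y) = (0, homog_eval Z y)].

End Representation.

Arguments Phi {R m} r M Z.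
Arguments homog_poly_vfield {R m} r V Y.
Arguments fibre {R m} r Y p.

(* Main.v *)
Require Import Defs.
From mathcomp Require Import all_boot all_order all_algebra.
From mathcomp Require Import all_classical all_reals all_analysis.
From HB Require Import structures.
From mathcomp Require Import complex.
From mathcomp Require mpoly.
Import -(notations) mpoly.
Import Order.TTheory GRing.Theory Num.Theory.
Import numFieldNormedType.Exports.

Set Implicit Arguments.
Unset Strict Implicit.
Unset Printing Implicit Defensive.

Local Open Scope classical_set_scope.
Local Open Scope ring_scope.

(** Fix a point p of V, a chart b in which p has coordinate t, and let B be the
    matrix A(p), Z the restriction of Y to the fibre over p. In the coordinates
    (t, y) the system reads X = (s(t), B(t) y), where s is the speed of d/dx in
    the chart, and Y = (0, Z(t)(y)). The first component of [Y, X] is zero, and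
    the second one at (t, y) is
<<
      B Z(y)  -  s(t) (d/dt) Z(t)(y)  -  sum_k (B y)_k (d/dy_k) Z(y).
>>
    On the other side, differentiating the push-forward
    M Z(M^-1 y), where M = exp(eps B), at eps = 0 gives
<<
      (Phi_r'(B) Z)(y)  =  B Z(y)  -  sum_k (B y)_k (d/dy_k) Z(y).
>>
    Hence the second component of [Y, X] is Phi_r'(B) Z - dY/dx, evaluated at y
    ([bracket_snd]), and the bracket is zero on the fibre over p exactly when the
    Lie-Vessiot equation holds at p ([bracket_eq0]). The theorem follows point by
    point; the differentiability of t |-> Z(t), which a solution must have, is a
    consequence of the analyticity of Y ([fibre_vderivable]).

    The derivatives in the Lie-Vessiot system are taken in the coordinates of an
    arbitrary basis of X^r[C^n], whereas those of the bracket are taken at a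
    fixed y. To pass from one to the other, observe that the functionals
    Z |-> Z(y)_i separate the points of X^r[C^n], because a polynomial which is
    zero as a function is zero ([mpoly_fun_eq0]). In finite dimension every
    linear functional is then a combination of finitely many of them
    ([separating_span]); so differentiability of all t |-> Z(t)(y)_i implies
    differentiability of the coordinates ([vderivable_separating]), and the
    derivative commutes with the functionals ([is_derive_functional]).

    Three analytic facts are needed on the way: the charts are continuous, so
    that the formula for Y holds on a neighbourhood of t ([chart_continuous]);
    exp(eps B) has derivative B at eps = 0 ([is_derive_expmx0]); and matrix
    inversion is differentiable ([is_derive_invmx]). *)

(** * Polynomials which vanish as functions *)

(** Uniqueness of the writing of an integer in base D. *)
Lemma digits_inj (D n : nat) (a b : 'I_n -> nat) :
  (forall i, (a i < D)%N) -> (forall i, (b i < D)%N) ->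
  (\sum_(i < n) a i * D ^ i = \sum_(i < n) b i * D ^ i)%N -> a =1 b.
Proof.
elim: n a b => [|n IH] a b aD bD; first by move=> _ [].
have split0 c : (\sum_(i < n.+1) c i * D ^ i =
    c ord0 + (\sum_(i < n) c (lift ord0 i) * D ^ i) * D)%N.
  rewrite big_ord_recl expn0 muln1 big_distrl /=; congr addn.
  by apply: eq_bigr => i _; rewrite expnS mulnCA mulnA [RHS]mulnC mulnA.
rewrite !split0 => eq_ab.
have D_gt0 : (0 < D)%N by apply: leq_trans (aD ord0).
have eq0 : a ord0 = b ord0.
  move/(congr1 (modn^~ D)): eq_ab.
  by rewrite /= ![(_ + _ * D)%N]addnC !modnMDl !modn_small.
move: eq_ab; rewrite eq0 => /addnI/eqP; rewrite eqn_pmul2r // => /eqP eqS.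
have eq_lift := IH _ _ (fun i => aD _) (fun i => bD _) eqS.
by move=> i; case: (unliftP ord0 i) => [j|] -> //; apply: eq_lift.
Qed.

Lemma poly_fun_eq0 (F : numDomainType) (p : {poly F}) :
  (forall x, p.[x] = 0) -> p = 0.
Proof.
move=> p0; apply/eqP/negPn/negP => pn0.
pose s : seq F := [seq i%:R | i <- iota 0 (size p)].
have : (size s < size p)%N.
  apply: max_poly_roots => //; first by apply/allP => x _; rewrite /root p0.
  rewrite map_inj_uniq ?iota_uniq // => i j /eqP.
  by rewrite eqr_nat => /eqP.
by rewrite size_map size_iota ltnn.
Qed.

(** Kronecker's substitution, X_i := x^(D^i) with D larger than all exponents,
    sends distinct monomials of p to distinct powers of x and so reduces the
    claim to one variable. *)
Lemma mpoly_fun_eq0 (F : numDomainType) (n : nat) (p : mpoly n F) :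
  (forall v, meval v p = 0) -> p = 0.
Proof.
move=> p0; pose D := msize p.
pose k (m : multinom n) := (\sum_(i < n) m i * D ^ i)%N.
have kinj : {in msupp p &, injective k}.
  have digit m i : m \in msupp p -> (m i < D)%N.
    move=> mp; apply: leq_ltn_trans (msize_mdeg_lt mp).
    by rewrite mdegE (bigD1 i) //= leq_addr.
  move=> m1 m2 m1p m2p /digits_inj eq12; apply/mnmP => i.
  by apply: eq12 => j; exact: digit.
pose q := \sum_(m <- msupp p) mcoeff m p *: 'X^(k m).
have q0 : q = 0.
  apply: poly_fun_eq0 => x.
  rewrite -[RHS](p0 (fun i => x ^+ (D ^ i))) mevalE horner_sum.
  apply: eq_bigr => m _; rewrite hornerZ hornerXn; congr (_ * _).
  rewrite /k -prodrXr; apply: eq_bigr => i _.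
  by rewrite -exprM mulnC.
apply/mpolyP => m; rewrite mcoeff0.
case: (boolP (m \in msupp p)) => [mp|/memN_msupp_eq0 //].
have : q`_(k m) = 0 by rewrite q0 coef0.
rewrite coef_sum (bigD1_seq m) ?msupp_uniq //= coefZ coefXn eqxx mulr1.
rewrite big_seq_cond big1 ?addr0 // => m' /andP[m'p ne].
rewrite coefZ coefXn; case: eqP => [/kinj eqm|_]; last by rewrite mulr0.
by rewrite (eqm mp m'p) eqxx in ne.
Qed.

(** * Separating families of linear functionals *)

(** Restrict the functionals to a subspace W: as long as W is nonzero, some
    functional is nonzero on W and its kernel cuts W down to a smaller
    dimension. *)
Lemma finite_separating (F : fieldType) (E : vectType F) (I : Type)
    (ev : I -> 'Hom(E, F^o)) :
  (forall z, (forall i, ev i z = 0) -> z = 0) ->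
  exists k (s : 'I_k -> I), forall z, (forall j, ev (s j) z = 0) -> z = 0.
Proof.
move=> ev_sep.
suff [s sP] : exists s : seq I, forall z, z \in fullv ->
    (forall j : 'I_(size s), ev (tnth (in_tuple s) j) z = 0) -> z = 0.
  by exists (size s), (tnth (in_tuple s)) => z; apply: sP; rewrite memvf.
have [d] := ubnP (\dim (fullv : {vspace E})).
elim: d (fullv : {vspace E}) => // d IH W; rewrite ltnS => dimW.
have [->|W0] := eqVneq W 0%VS.
  by exists [::] => z; rewrite memv0 => /eqP.
have [i evi] : exists i, ev i (vpick W) != 0.
  apply: contrapT => /forallNP h; move/negP: W0; rewrite -vpick0; apply.
  by apply/eqP/ev_sep => i; apply/eqP; move/negP/negPn: (h i).
have [|s sP] := IH (W :&: lker (ev i))%VS.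
  apply: leq_trans dimW.
  rewrite ltn_neqAle dimvS ?capvSl // andbT; apply: contra evi => /eqP dimE.
  have /eqP WE : (W :&: lker (ev i) == W)%VS by rewrite eqEdim capvSl dimE /=.
  by have := memv_pick W; rewrite -{2}WE memv_cap memv_ker => /andP[].
exists (i :: s) => z zW z0; apply: sP.
  by rewrite memv_cap zW memv_ker (z0 ord0) /=.
by move=> j; have := z0 (lift ord0 j); rewrite !(tnth_nth i).
Qed.

(** A finite separating family is an injective linear map to F^k; composing
    phi with a left inverse of this map gives the coefficients. *)
Lemma separating_span (F : fieldType) (E : vectType F) (I : Type)
    (ev : I -> 'Hom(E, F^o)) (phi : 'Hom(E, F^o)) :
  (forall z, (forall i, ev i z = 0) -> z = 0) ->
  exists k (s : 'I_k -> I) (c : 'I_k -> F),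
    forall z, phi z = \sum_j c j * ev (s j) z.
Proof.
move=> ev_sep; have [k [s sP]] := finite_separating ev_sep.
pose L z : 'rV[F]_k := \row_j ev (s j) z.
have L_lin : linear L.
  by move=> a u v; apply/rowP => j; rewrite !mxE linearP.
pose L_mixin := GRing.isLinear.Build _ _ _ _ L L_lin.
pose L_linear : {linear E -> 'rV[F]_k} := HB.pack L L_mixin.
pose f : 'Hom(E, 'rV[F]_k) := linfun L_linear.
have fE z : f z = L z by exact: (lfunE L_linear).
have f_inj : lker f == 0%VS.
  apply/lker0P => u v fuv; apply/eqP; rewrite -subr_eq0; apply/eqP/sP => j.
  have /rowP/(_ j) : L u = L v by rewrite -!fE fuv.
  by rewrite !mxE linearB /= => ->; rewrite subrr.
exists k, s, (fun j => phi ((f^-1)%VF (delta_mx 0 j))) => z.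
rewrite -{1}(lker0_lfunK f_inj z) fE [L z]row_sum_delta !linear_sum.
by apply: eq_bigr => j _; rewrite !linearZ /= mxE mulrC.
Qed.

(** * Rules for directional derivatives *)

Lemma is_derive_linear (K : numFieldType) (V W W' : normedModType K)
    (L : {linear W -> W'}) (f : V -> W) a v :
  continuous L -> derivable f a v -> is_derive a v (L \o f) (L ('D_v f a)).
Proof.
move=> Lc df.
have quotient : (fun h => h^-1 *: ((L \o f) (h *: v + a) - (L \o f) a)) =
    L \o (fun h => h^-1 *: (f (h *: v + a) - f a)).
  apply: funext => h; rewrite [RHS]/= [RHS]linearZ /=; congr (_ *: _).
  exact: esym (raddfB L _ _).
have quotient_cvg :
    (fun h => h^-1 *: ((L \o f) (h *: v + a) - (L \o f) a)) @ 0^' -->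
    L ('D_v f a).
  by rewrite quotient; apply: continuous_cvg; [exact: Lc | exact: df].
apply: DeriveDef; first by apply/cvg_ex; eexists; exact: quotient_cvg.
by apply: cvg_lim => //; exact: quotient_cvg.
Qed.

(** A directional derivative is the derivative of the restriction to a line. *)
Lemma is_derive_along (K : numFieldType) (V W : normedModType K) (f : V -> W)
    (g : K -> W) (a v : V) (t : K) (d : W) :
  (forall h, g (h + t) = f (h *: v + a)) ->
  is_derive a v f d -> is_derive t 1 g d.
Proof.
move=> gf [fd <-].
have quotient : (fun h => h^-1 *: (f (h *: v + a) - f a)) =
    (fun h => h^-1 *: (g (h *: (1 : K) + t) - g t)).
  have fa : f a = g t by rewrite -[t]add0r gf scale0r add0r.
  by apply: funext => h; rewrite [h *: 1]mulr1 gf fa.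
by split; rewrite /derivable /derive /= quotient // in fd *.
Qed.

Section ScalarFunctions.
Context {K : numFieldType} {V : normedModType K}.
Implicit Types (x v : V).

Lemma is_derive_sumf (I : Type) (r : seq I) (P : pred I) (f : I -> V -> K)
    (df : I -> K) x v :
  (forall i, P i -> is_derive x v (f i) (df i)) ->
  is_derive x v (fun t => \sum_(i <- r | P i) f i t)
    (\sum_(i <- r | P i) df i).
Proof.
move=> fd; elim: r => [|i r IH].
  by under eq_fun do rewrite big_nil; rewrite big_nil; exact: is_derive_cst.
rewrite big_cons; under eq_fun do rewrite big_cons.
by case: ifPn => // /fd ?; exact: is_deriveD.
Qed.

Lemma derivable_sumf (I : Type) (r : seq I) (P : pred I) (f : I -> V -> K)
    x v :
  (forall i, P i -> derivable (f i) x v) ->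
  derivable (fun t => \sum_(i <- r | P i) f i t) x v.
Proof.
by move=> fd; have [] := is_derive_sumf r (fun i Pi => derivableP (fd i Pi)).
Qed.

Lemma is_deriveMf (f g : V -> K) (df dg : K) x v :
  is_derive x v f df -> is_derive x v g dg ->
  is_derive x v (fun t => f t * g t) (df * g x + f x * dg).
Proof.
move=> fd gd; have /= := is_deriveM fd gd.
by rewrite addrC [_ *: df]mulrC.
Qed.

Lemma derivable_prodf (I : Type) (r : seq I) (P : pred I) (f : I -> V -> K)
    x v :
  (forall i, P i -> derivable (f i) x v) ->
  derivable (fun t => \prod_(i <- r | P i) f i t) x v.
Proof.
move=> fd; elim: r => [|i r IH].
  by under eq_fun do rewrite big_nil; exact: derivable_cst.
under eq_fun do rewrite big_cons.
by case: ifPn => // /fd ?; exact: derivableM.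
Qed.

Lemma derivable_det (n : nat) (M : V -> 'M[K]_n) x v :
  (forall i j, derivable (fun t => M t i j) x v) ->
  derivable (fun t => \det (M t)) x v.
Proof.
move=> Md; rewrite /determinant.
apply: derivable_sumf => s _; apply: derivableM; first exact: derivable_cst.
by apply: derivable_prodf => i _; exact: Md.
Qed.

(** The chain rule for a polynomial map holds for constants and variables, and
    is stable under sums and products by the Leibniz rule for formal partial
    derivatives. *)
Lemma is_derive_meval (n : nat) (c : V -> 'I_n -> K) (dc : 'I_n -> K) x v
    (p : mpoly n K) :
  (forall i, is_derive x v (c^~ i) (dc i)) ->
  is_derive x v (fun t => meval (c t) p)
    (\sum_i dc i * meval (c x) (mderiv i p)).
Proof.
move=> cd; pose D p := \sum_i dc i * meval (c x) (mderiv i p).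
pose P q := is_derive x v (fun t => meval (c t) q) (D q).
have PC a : P (mpolyC n a).
  rewrite /P /D big1 => [|i _]; last by rewrite mderivC meval0 mulr0.
  by under eq_fun do rewrite mevalC; exact: is_derive_cst.
have PD p1 p2 : P p1 -> P p2 -> P (p1 + p2).
  move=> d1 d2; rewrite /P.
  have -> : D (p1 + p2) = D p1 + D p2.
    rewrite /D -big_split; apply: eq_bigr => i _ /=.
    by rewrite mderivD mevalD mulrDr.
  have -> : (fun t => meval (c t) (p1 + p2)) =
      (fun t => meval (c t) p1) + (fun t => meval (c t) p2).
    by apply: funext => t; rewrite mevalD.
  exact: is_deriveD.
have PM p1 p2 : P p1 -> P p2 -> P (p1 * p2).
  move=> d1 d2; rewrite /P.
  have -> : D (p1 * p2) = D p1 * meval (c x) p2 + meval (c x) p1 * D p2.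
    rewrite /D mulr_suml mulr_sumr -big_split; apply: eq_bigr => i _ /=.
    by rewrite mderivM mevalD !mevalM mulrDr mulrA [in RHS]mulrCA.
  have -> : (fun t => meval (c t) (p1 * p2)) =
      (fun t => meval (c t) p1 * meval (c t) p2).
    by apply: funext => t; rewrite mevalM.
  exact: is_deriveMf.
have PX i : P (mpolyX K (mnm1 i)).
  rewrite /P /D (bigD1 i) //= big1 => [|j ji].
    have subUU : mnm_sub (mnm1 i) (mnm1 i) = (mnm0 : multinom n).
      by apply/mnmP => j; rewrite mnmBE subnn mnm0E.
    rewrite mderivX mnm1E eqxx scale1r subUU mpolyX0 meval1 mulr1 addr0.
    by under eq_fun do rewrite mevalXU; exact: cd.
  by rewrite mderivX mnm1E eq_sym (negPf ji) scale0r meval0 mulr0.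
suff: P p by [].
rewrite [p]mpolyE; apply: big_ind => // [|m _].
  by rewrite -(mpolyC0 n K).
rewrite -mul_mpolyC; apply: (PM _ _ (PC _)).
rewrite mpolyXE_id; apply: big_ind => // [|i _]; first exact: PC.
by elim: (m i) => [|k IH]; [exact: PC | rewrite exprS; apply: PM].
Qed.

End ScalarFunctions.

Section MatrixInverse.
Context {K : numFieldType} {n : nat}.
Variables (M : K -> 'M[K]_n) (dM : 'M[K]_n) (x : K).
Hypothesis Mu : M x \in unitmx.
Hypothesis Md : forall i j, is_derive x 1 (fun t => M t i j) (dM i j).

Lemma near_unitmx : \forall t \near x, M t \in unitmx.
Proof.
have : {for x, continuous (fun t => \det (M t))}.
  apply: differentiable_continuous; apply/derivable1_diffP/derivable_det.
  by move=> i j; case: (Md i j).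
move=> /cvgr_neq0; rewrite -unitfE -unitmxE => /(_ Mu).
by apply: filterS => t; rewrite unitmxE unitfE.
Qed.

(** Cramer's rule: near x the inverse is the adjugate over the determinant. *)
Lemma derivable_invmx i j : derivable (fun t => invmx (M t) i j) x 1.
Proof.
have near_inv :
    \forall t \near x, (\det (M t))^-1 * \adj (M t) i j = invmx (M t) i j.
  by apply: filterS near_unitmx => t tu; rewrite /invmx tu [RHS]mxE.
apply: near_eq_derivable near_inv _.
apply: derivableM.
  apply: derivableV; first by rewrite -unitfE -unitmxE.
  by apply: derivable_det => k l; case: (Md k l).
under eq_fun do rewrite mxE.
apply: derivableM; first exact: derivable_cst.
apply: derivable_det => k l; under eq_fun do rewrite !mxE.
by case: (Md (lift j k) (lift i l)).
Qed.

(** Once differentiability is known, differentiate M N = 1. *)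
Lemma is_derive_invmx i j : is_derive x 1 (fun t => invmx (M t) i j)
    ((- (invmx (M x) *m dM *m invmx (M x))) i j).
Proof.
pose dN := \matrix_(i, j) 'D_1 (fun t => invmx (M t) i j) x.
have dNP k l : is_derive x 1 (fun t => invmx (M t) k l) (dN k l).
  by rewrite mxE; exact/derivableP/derivable_invmx.
suff <- : dN = - (invmx (M x) *m dM *m invmx (M x)) by [].
have Leibniz : dM *m invmx (M x) + M x *m dN = 0.
  apply/matrixP => k l; rewrite !mxE -big_split /=.
  have : is_derive x 1 (fun t => (M t *m invmx (M t)) k l)
      (\sum_m (dM k m * invmx (M x) m l + M x k m * dN m l)).
    under eq_fun do rewrite mxE.
    by apply: is_derive_sumf => m _; apply: is_deriveMf.
  case=> _ <-.
  rewrite (@near_eq_derive _ _ _ _ (cst ((1%:M : 'M[K]_n) k l))) ?derive_cst //.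
  by apply: filterS near_unitmx => t tu; rewrite mulmxV.
rewrite -mulmxA -mulmxN; move/eqP: Leibniz; rewrite addrC addr_eq0 => /eqP <-.
by rewrite mulKmx.
Qed.

End MatrixInverse.

(** * Derivatives of maps into a finite-dimensional space *)

Section VectorValued.
Context {R : realType} {E : vectType (Cplx R)}.
Local Notation C := (Cplx R).

Lemma is_derive_functional (phi : 'Hom(E, C^o)) (v : C -> E) (t : C) :
  vderivable v t ->
  is_derive t (1 : C) (fun s => phi (v s) : C) (phi (vderive v t)).
Proof.
move=> vd.
have -> : (fun s => phi (v s) : C) = fun s =>
    \sum_i coord (vbasis fullv) i (v s) * (phi (vbasis fullv)`_i : C).
  apply: funext => s; rewrite {1}(coord_vbasis (memvf (v s))) linear_sum.
  by apply: eq_bigr => i _; rewrite linearZ.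
rewrite /vderive linear_sum; apply: is_derive_sumf => i _.
rewrite linearZ /=.
have := is_deriveMf (derivableP (vd i))
  (is_derive_cst (phi (vbasis fullv)`_i : C) t 1).
by rewrite mulr0 addr0 derive1E.
Qed.

(** The coordinates are combinations of functionals of the family, by
    [separating_span]. *)
Lemma vderivable_separating (I : Type) (ev : I -> 'Hom(E, C^o)) (v : C -> E)
    (t : C) :
  (forall z, (forall i, ev i z = 0) -> z = 0) ->
  (forall i, derivable (fun s => ev i (v s) : C) t 1) -> vderivable v t.
Proof.
move=> ev_sep evd i.
have [k [s [c sE]]] :=
  separating_span (linfun (coord (vbasis fullv) i)) ev_sep.
have -> : (fun s => coord (vbasis fullv) i (v s)) =
    fun u => \sum_j c j * (ev (s j) (v u) : C).
  by apply: funext => u; rewrite -sE lfunE.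
apply: derivable_sumf => j _; apply: derivableM; first exact: derivable_cst.
exact: evd.
Qed.

End VectorValued.

(** * The derivative of the matrix exponential at the origin *)

Lemma norm_cvg_le (K : numFieldType) (V : normedModType K) (u : nat -> V)
    (l b : V) (B : K) :
  u @ \oo --> l -> (\forall n \near \oo, `|u n - b| <= B) -> `|l - b| <= B.
Proof.
move=> ul uB; have [N _ /(_ N (leqnn N)) BN] := uB.
have B_real : B \is Num.real by apply: ger0_real; apply: le_trans BN.
rewrite real_leNgt ?normr_real //; apply/negP => Blt.
have /cvgrPdist_lt /(_ (`|l - b| - B)) := ul.
rewrite subr_gt0 => /(_ Blt) ul'.
have [n [un lun]] := filter_ex (filterI uB ul').
have := ler_distD (u n) l b.
rewrite real_leNgt ?realD ?normr_real // => /negP; apply.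
by rewrite -(subrK B `|l - b|); apply: ltr_leD.
Qed.

Lemma cvg_affine_comb (K : numFieldType) (u v : nat -> K) (c p q : K) :
  u @ \oo --> p -> v @ \oo --> q ->
  (fun n => u n + c * v n) @ \oo --> p + c * q.
Proof.
by move=> up vq; apply: cvgD => //; apply: cvgM => //; exact: cvg_cst.
Qed.

Lemma cvg_mx (K : numFieldType) (m n : nat) (T : Type) (F : set_system T)
    {FF : Filter F} (f : T -> 'M[K]_(m, n)) (l : 'M[K]_(m, n)) :
  (forall i j, (fun t => f t i j) @ F --> l i j) -> f @ F --> l.
Proof.
move=> fl; apply/cvg_ballP => e e0.
have near_ij i j : \forall t \near F, ball (l i j) e (f t i j).
  by move/cvg_ballP: (fl i j); apply.
have : \forall t \near F, forall i j, ball (l i j) e (f t i j).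
  by apply: filter_forall => i; apply: filter_forall => j.
by apply: filterS => t h.
Qed.

Lemma is_derive_taylor0 (K : numFieldType) (f : K -> K) (c0 c1 B : K) :
  0 <= B ->
  (forall x, `|x| <= 1 -> `|f x - (c0 + c1 * x)| <= B * `|x| ^+ 2) ->
  f 0 = c0 /\ is_derive (0 : K) (1 : K) f c1.
Proof.
move=> B_ge0 taylor.
have f0 : f 0 = c0.
  have := taylor 0; rewrite normr0 ler01 mulr0 addr0 expr0n mulr0 => /(_ isT).
  by rewrite normr_le0 subr_eq0 => /eqP.
split=> //.
have B1_gt0 : 0 < B + 1 by rewrite ltr_wpDl.
have quotient_cvg :
    (fun h => h^-1 *: (f (h *: 1 + 0) - f 0)) @ (0 : K)^' --> c1.
  apply/cvgrPdist_le => e e0.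
  near=> h.
  have h0 : h != 0 by near: h; exact: nbhs_dnbhs_neq.
  have h1 : `|h| <= 1 by near: h; exact: dnbhs0_le.
  (* B + 1 rather than B, which may be zero *)
  have he : `|h| <= e / (B + 1).
    by near: h; apply: dnbhs0_le; exact: divr_gt0.
  have -> : c1 - h^-1 *: (f (h *: 1 + 0) - f 0) =
      - (h^-1 * (f h - (c0 + c1 * h))).
    rewrite [h *: 1]mulr1 addr0 f0 opprD addrA mulrBr [h^-1 * (c1 * h)]mulrCA.
    by rewrite mulVf // mulr1 opprB.
  rewrite normrN normrM normfV ler_pdivrMl ?normr_gt0 //.
  apply: le_trans (taylor h h1) _; rewrite expr2 mulrA mulrC ler_wpM2l //.
  move: he; rewrite ler_pdivlMr //; apply: le_trans.
  by rewrite mulrDr mulr1 mulrC lerDl.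
split; first by apply/cvg_ex; eexists; exact: quotient_cvg.
by apply: cvg_lim => //; exact: quotient_cvg.
Unshelve. all: by end_near. Qed.

Section ComplexSeries.
Context {R : realType}.
Local Notation C := (Cplx R).

(** The embedding of R in C, with a codomain that carries the topology. *)
Definition real_to_C (x : R) : C := (x%:C)%C.

Lemma norm_real_to_C x : `|real_to_C x| = real_to_C `|x|.
Proof. by rewrite normc_def /= expr0n addr0 sqrtr_sqr. Qed.

Lemma cvg_real_to_C (T : Type) (F : set_system T) {FF : Filter F}
    (u : T -> R) (l : R) :
  u @ F --> l -> (real_to_C \o u) @ F --> real_to_C l.
Proof.
move=> ul; apply/cvgrPdist_lt => e e0.
have eE : e = real_to_C (complex.Re e).
  by rewrite /real_to_C RRe_real // gtr0_real.
have re_gt0 : 0 < complex.Re e by rewrite -ltcR -[X in _ < X]eE.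
move/cvgrPdist_lt: ul => /(_ _ re_gt0); apply: filterS => t ht.
by rewrite eE /= -rmorphB norm_real_to_C ltcR.
Qed.

(** The real and imaginary parts are real series to which the comparison test
    applies. *)
Lemma dominated_series (z : C^nat) (a : R^nat) :
  (forall k, `|z k| <= real_to_C (a k)) -> cvgn (series a) -> cvgn (series z).
Proof.
move=> za acv.
have real_part (w : R^nat) :
    (forall k, `|real_to_C (w k)| <= `|z k|) -> cvgn (series w).
  move=> wz; apply: (@normed_cvg _ R^o).
  apply: (series_le_cvg _ _ _ acv) => k.
  - exact: normr_ge0.
  - by rewrite -ler0c; apply: le_trans (za k).
  - rewrite -lecR; apply: le_trans (za k).
    by rewrite -[X in X <= _]norm_real_to_C.
have /cvg_ex[/= p rep] : cvgn (series (fun k => complex.Re (z k))).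
  by apply: real_part => k; rewrite norm_real_to_C; exact: normc_ge_Re.
have /cvg_ex[/= q imq] : cvgn (series (fun k => complex.Im (z k))).
  apply: real_part => k; rewrite norm_real_to_C -normrN -ReiNIm.
  apply: le_trans (normc_ge_Re _) _.
  by rewrite normrM (normc_def 'i%C) /= expr0n add0r expr1n sqrtr1 mulr1.
suff : series z @ \oo --> (real_to_C p + ('i%C : C) * real_to_C q).
  by move/cvgP; exact.
have -> : series z = fun n => real_to_C (series (fun k => complex.Re (z k)) n) +
    ('i%C : C) * real_to_C (series (fun k => complex.Im (z k)) n).
  apply: funext => n; rewrite /series /= /real_to_C !rmorph_sum /= mulr_sumr.
  by rewrite -big_split /=; apply: eq_bigr => k _; rewrite -complexE.
exact: cvg_affine_comb (cvg_real_to_C rep) (cvg_real_to_C imq).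
Qed.

(** The terms of degree at least 2 are bounded by |x|^2 times the sum of the
    dominating series, uniformly in the partial sum. *)
Lemma power_series_taylor1 (c : C^nat) (a : R^nat) (f : C -> C) :
  (forall k, `|c k| <= real_to_C (a k)) -> cvgn (series a) ->
  (forall x, `|x| <= 1 -> series (fun k => c k * x ^+ k) @ \oo --> f x) ->
  exists2 B : C, 0 <= B &
    forall x, `|x| <= 1 -> `|f x - (c 0%N + c 1%N * x)| <= B * `|x| ^+ 2.
Proof.
move=> ca acv fE.
pose B := limn (series a).
have a_ge0 k : 0 <= a k by rewrite -ler0c; apply: le_trans (ca k).
have aB N : series a N <= B.
  apply: nondecreasing_cvgn_le => //.
  by apply: nondecreasing_series => k _ _; exact: a_ge0.
exists (real_to_C B).
  by rewrite ler0c; apply: le_trans (aB 0%N); rewrite /series /= big_nil.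
move=> x x1; apply: norm_cvg_le (fE x x1) _.
exists 2%N => // N /= N2.
rewrite /series /= big_ltn ?(leq_trans _ N2) // big_ltn // expr0 mulr1 expr1.
rewrite addrA [X in `|X|]addrC addKr.
apply: (le_trans (ler_norm_sum _ _ _)).
apply: (@le_trans _ _ (\sum_(2 <= k < N) real_to_C (a k) * `|x| ^+ 2)).
  rewrite big_nat_cond [leRHS]big_nat_cond.
  apply: ler_sum => k /andP[/andP[k2 _] _].
  by rewrite normrM normrX ler_pM ?exprn_ge0 // ler_wiXn2l.
rewrite -mulr_suml ler_wpM2r ?exprn_ge0 // /real_to_C -rmorph_sum lecR.
apply: le_trans (aB N); rewrite /series /= [leRHS](big_cat_nat (n := 2%N)) //=.
by rewrite lerDr sumr_ge0.
Qed.

End ComplexSeries.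

Section MatrixExponential.
Context {R : realType} {n : nat}.
Local Notation C := (Cplx R).
Implicit Type M : 'M[C]_n.+1.

Lemma norm_exprmx_le M (k : nat) i j :
  `|(M ^+ k) i j| <= (\sum_p \sum_q `|M p q|) ^+ k.
Proof.
have L_ge0 : 0 <= \sum_p \sum_q `|M p q|.
  by apply: sumr_ge0 => p _; apply: sumr_ge0.
elim: k i j => [|k IH] i j.
  by rewrite !expr0 mxE; case: eqP => _; rewrite ?normr1 ?normr0.
rewrite exprS mxE; apply: le_trans (ler_norm_sum _ _ _) _.
rewrite exprS.
apply: (@le_trans _ _ (\sum_q `|M i q| * (\sum_p \sum_q `|M p q|) ^+ k)).
  by apply: ler_sum => q _; rewrite normrM ler_wpM2l.
rewrite -mulr_suml ler_wpM2r ?exprn_ge0 //.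
rewrite [leRHS](bigD1 i) //= lerDl; apply: sumr_ge0 => p _; exact: sumr_ge0.
Qed.

(** Each entry of exp(x M) is a power series in x, with k-th coefficient
    (M^k)_ij / k!; these series are dominated on the unit disc by the real
    exponential series at the sum of the absolute values of the entries. *)
Lemma is_derive_expmx0 M :
  expmx (0 *: M) = 1%:M /\
  forall i j,
    is_derive (0 : C) (1 : C) (fun x : C => expmx (x *: M) i j) (M i j).
Proof.
pose L := \sum_p \sum_q `|M p q|.
have L_ge0 : 0 <= L by apply: sumr_ge0 => p _; apply: sumr_ge0.
have LE : L = real_to_C (complex.Re L).
  by rewrite /real_to_C RRe_real // ger0_real.
pose a := exp_coeff (complex.Re L).
have a_cv : cvgn (series a) := is_cvg_series_exp_coeff _.
pose c i j k : C := (k`!%:R)^-1 * (M ^+ k) i j.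
have ca i j k : `|c i j k| <= real_to_C (a k).
  have -> : real_to_C (a k) = (k`!%:R)^-1 * L ^+ k.
    rewrite LE /a /exp_coeff /real_to_C /=.
    by rewrite rmorphM rmorphXn fmorphV rmorph_nat mulrC.
  rewrite /c normrM normfV normr_nat ler_wpM2l ?invr_ge0 ?ler0n //.
  exact: norm_exprmx_le.
have expE x i j : `|x| <= 1 ->
    series (fun k => c i j k * x ^+ k) @ \oo --> expmx (x *: M) i j.
  move=> x1.
  have cv p q : cvgn (series (fun k => c p q k * x ^+ k)).
    apply: dominated_series a_cv => k; apply: le_trans (ca p q k).
    by rewrite normrM normrX ler_piMr // exprn_ile1.
  pose u k := (k`!%:R)^-1 *: (x *: M) ^+ k.
  have entry p q : (fun N => series u N p q) =
      series (fun k => c p q k * x ^+ k).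
    apply: funext => N; rewrite /series /= summxE; apply: eq_bigr => k _.
    by rewrite /u exprZn !mxE /c -mulrA [_ * x ^+ k]mulrC.
  pose S : 'M[C]_n.+1 :=
    \matrix_(p, q) limn (series (fun k => c p q k * x ^+ k)).
  have uS : series u @ \oo --> S.
    by apply: cvg_mx => p q; rewrite entry mxE; exact: cv.
  have -> : expmx (x *: M) = S by exact: (cvg_lim (@norm_hausdorff _ _) uS).
  by rewrite mxE; exact: cv.
have c0 i j : c i j 0%N = (1%:M : 'M[C]_n.+1) i j.
  by rewrite /c fact0 invr1 mul1r.
have c1 i j : c i j 1%N = M i j by rewrite /c invr1 mul1r.
have entries i j : expmx (0 *: M) i j = c i j 0%N /\
    is_derive (0 : C) (1 : C) (fun x : C => expmx (x *: M) i j) (c i j 1%N).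
  have [B B_ge0 taylor] :=
    power_series_taylor1 (ca i j) a_cv (fun x => @expE x i j).
  exact: is_derive_taylor0 B_ge0 taylor.
split; first by apply/matrixP => i j; rewrite -c0; case: (entries i j).
by move=> i j; rewrite -c1; case: (entries i j).
Qed.

End MatrixExponential.

(** * Continuity of the charts of the Riemann sphere *)

Section RiemannSphere.
Context {R : realType}.
Local Notation C := (Cplx R).
Local Notation CP1 := (CP1 R).

Lemma compact_norm_bounded (D : set C) :
  compact D -> exists N : nat, forall z, D z -> `|z| <= N%:R.
Proof.
move=> /compact_near_coveringP cD.
suff /filter_ex[N bN] :
    \forall N \near \oo, D `<=` (fun z : C => `|z| <= N%:R).
  by exists N.
apply: (cD nat \oo (fun N z => `|z| <= N%:R)) => z Dz.
have [N zN] : exists N : nat, `|z| + 1 <= N%:R.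
  exists (Num.Def.archi_bound (complex.Re (`|z| + 1))).
  have r_real : `|z| + 1 \is Num.real by rewrite realD ?normr_real.
  rewrite -[leLHS](RRe_real r_real) -(rmorph_nat (real_complex R)) lecR.
  apply/ltW/archi_boundP; rewrite -ler0c (RRe_real r_real).
  by rewrite addr_ge0.
exists (ball z 1, [set n | (N <= n)%N]).
  split; first exact: nbhsx_ballx.
  by exists N.
move=> [w k] /= [zw Nk].
have : `|z - w| < 1 := zw.
rewrite distrC => zw'.
apply: le_trans (_ : N%:R <= _); last by rewrite ler_nat.
apply: le_trans zN; rewrite -[w](subrK z) [leRHS]addrC.
by apply: le_trans (ler_normD _ _) _; rewrite lerD2r ltW.
Qed.

(** At t = 0 in the chart at infinity: a neighbourhood of infinity contains the
    complement of a compact set, hence all 1/t with |t| small. *)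
Lemma chart_continuous b : continuous (chart b : C -> CP1).
Proof.
case: b => t; first exact: one_point_compactification_some_continuous.
have [->|t0] := eqVneq t 0.
  rewrite /continuous_at /= eqxx => W [D [cD _] DW].
  have [N bN] := compact_norm_bounded cD.
  (* N may be zero, hence the radius 1 / (N + 1) *)
  have N1 : 0 < (N.+1%:R)^-1 :> C by rewrite invr_gt0 ltr0n.
  suff : \forall s \near (0 : C), W (chart Infinity s) by [].
  apply: filterS (nbhs0_lt N1) => s sN; apply: DW => /=.
  case: eqP => [_|/eqP s0]; [by right | left; exists s^-1 => //].
  move/bN; rewrite normfV => sN'.
  move: sN; rewrite -ltf_pV2 ?posrE ?normr_gt0 // invrK => /lt_le_trans.
  by move=> /(_ _ sN'); rewrite ltr_nat ltnNge leqnSn.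
have inv_cvg : (fun s : C => Some s^-1 : CP1) @ t --> (Some t^-1 : CP1).
  have inv_t : (fun s : C => s^-1) @ t --> t^-1.
    exact: (inv_continuous t0).
  by move=> W tW; exact: (inv_t _ tW).
have near0 : \forall s \near t, s != 0.
  have id_t : (fun s : C => s) @ t --> t by exact: cvg_id.
  exact: (cvgr_neq0 _ id_t t0).
rewrite /continuous_at /= (negPf t0) => W /inv_cvg tW.
suff : \forall s \near t, W (chart Infinity s) by [].
by apply: filterS2 near0 tW => s s0 sW; rewrite /= (negPf s0).
Qed.

End RiemannSphere.

(** * The infinitesimal push-forward *)

Section PushForward.
Context {R : realType} {m r : nat}.
Local Notation C := (Cplx R).
Local Notation n := m.+1.
Implicit Types (Z : homog_vfield R m r) (y : 'cV[C]_n) (q : 'cV[C]_n * 'I_n).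

Definition component_at_fun q Z : C^o := homog_eval Z q.1 q.2 0.

Lemma component_at_linear q : linear (component_at_fun q).
Proof.
move=> a Z Z'; rewrite /component_at_fun !mxE !ffunE.
by rewrite /= mevalD mevalZ.
Qed.

HB.instance Definition _ q :=
  GRing.isLinear.Build C (homog_vfield R m r) C^o *:%R
    (component_at_fun q) (component_at_linear q).

(** The point and the index of the component form a pair q, so that these
    functionals are one family, to which [vderivable_separating] applies. *)
Definition component_at q : 'Hom(homog_vfield R m r, C^o) :=
  linfun (component_at_fun q).

Lemma component_atE q Z : component_at q Z = homog_eval Z q.1 q.2 0.
Proof. by rewrite lfunE. Qed.

Lemma component_at_separating Z : (forall q, component_at q Z = 0) -> Z = 0.
Proof.
move=> Z0; apply/ffunP => i; apply: val_inj; rewrite ffunE /=.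
apply: mpoly_fun_eq0 => v; have := Z0 (\col_j v j, i).
rewrite component_atE mxE /= => Zv.
by rewrite -[RHS]Zv; apply: meval_eq => j; rewrite mxE.
Qed.

Lemma eq_component_at Z Z' :
  (forall q, component_at q Z = component_at q Z') -> Z = Z'.
Proof.
move=> ZZ'; apply/eqP; rewrite -subr_eq0; apply/eqP/component_at_separating.
by move=> q; rewrite linearB /= ZZ' subrr.
Qed.

(** Differentiate M Z(M^-1 y) at M = 1: the outer factor contributes B Z(y), and
    the inner one, whose derivative is - B y, contributes the derivative of Z in
    the direction - B y. *)
Lemma is_derive_push (M : C -> 'M[C]_n) (B : 'M[C]_n) Z y i :
  M 0 = 1%:M ->
  (forall k l, is_derive (0 : C) (1 : C) (fun x => M x k l) (B k l)) ->
  is_derive (0 : C) (1 : C)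
    (fun x : C => component_at (y, i) (Phi r (M x) Z) : C)
    ((B *m homog_eval Z y) i 0 -
      \sum_k (B *m y) k 0 * meval (fun j => y j 0) (mderiv k (Z i))).
Proof.
move=> M0 Md.
have -> : (fun x : C => component_at (y, i) (Phi r (M x) Z) : C) = (fun x : C =>
    \sum_j M x i j * meval (fun k => (invmx (M x) *m y) k 0) (Z j)).
  apply: funext => x; rewrite component_atE homog_eval_Phi mxE /=.
  by apply: eq_bigr => j _; rewrite mxE.
have M_unit : M 0 \in unitmx by rewrite M0 unitmx1.
pose N x k : C := (invmx (M x) *m y) k 0.
have N0 : N 0 =1 fun k => y k 0 by move=> k; rewrite /N M0 invmx1 mul1mx.
have Nd k : is_derive (0 : C) (1 : C) (N^~ k) (- (B *m y) k 0).
  have -> : N^~ k = (fun x : C => \sum_l invmx (M x) k l * y l 0).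
    by apply: funext => x; rewrite /N mxE.
  rewrite mxE -sumrN.
  apply: is_derive_sumf => l _.
  have := is_deriveMf (is_derive_invmx M_unit Md k l)
    (is_derive_cst (y l 0) (0 : C) (1 : C)).
  by rewrite M0 invmx1 mul1mx mulmx1 mulr0 addr0 mxE mulNr.
have term j : is_derive (0 : C) (1 : C) (fun x => M x i j * meval (N x) (Z j))
    (B i j * homog_eval Z y j 0 + (i == j)%:R *
      - \sum_k (B *m y) k 0 * meval (fun j => y j 0) (mderiv k (Z j))).
  apply: is_derive_eq (is_deriveMf (Md i j) (is_derive_meval (Z j) Nd)) _.
  congr (_ * _ + _ * _); first by rewrite mxE; apply: meval_eq.
    by rewrite M0 mxE.
  rewrite -sumrN; apply: eq_bigr => k _; rewrite mulNr; congr (- (_ * _)).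
  exact: meval_eq.
have pick_i (g : 'I_n -> C) : \sum_j (i == j)%:R * g j = g i.
  rewrite (bigD1 i) //= eqxx mul1r big1 ?addr0 // => j ji.
  by rewrite eq_sym (negPf ji) mul0r.
apply: is_derive_eq
  (is_derive_sumf (index_enum 'I_n) (fun j (_ : true) => term j)) _.
rewrite big_split /= [in RHS]mxE; congr (_ + _).
exact: (pick_i (fun j =>
  - \sum_k (B *m y) k 0 * meval (fun j => y j 0) (mderiv k (Z j)))).
Qed.

Lemma component_at_rep_diff (B : 'M[C]_n) Z y i :
  component_at (y, i) (rep_diff (Phi r) B Z) =
    (B *m homog_eval Z y) i 0 -
    \sum_k (B *m y) k 0 * meval (fun j => y j 0) (mderiv k (Z i)).
Proof.
have [exp0 exp_d] := is_derive_expmx0 B.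
have vd : vderivable (fun x : C => Phi r (expmx (x *: B)) Z) 0.
  apply: (vderivable_separating component_at_separating) => -[y' i'].
  by case: (is_derive_push Z y' i' exp0 exp_d).
have [_ <-] := is_derive_functional (component_at (y, i)) vd.
by have [_ ->] := is_derive_push Z y i exp0 exp_d.
Qed.

End PushForward.

(** * Components of maps into C x C^n *)

Section ProductComponents.
Context {K : numFieldType} {n : nat}.
Local Notation KK := (K * 'cV[K]_n.+1)%type.

Definition snd_coord (i : 'I_n.+1) (q : KK) : K := q.2 i 0.

Lemma snd_coord_linear i : linear (snd_coord i : KK -> K^o).
Proof. by move=> a q q'; rewrite /snd_coord !mxE. Qed.

HB.instance Definition _ i :=
  GRing.isLinear.Build K KK K^o *:%R (snd_coord i) (snd_coord_linear i).

Lemma snd_coord_continuous i : continuous (snd_coord i).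
Proof.
move=> q; apply: (@cvg_comp _ _ _ snd (fun w : 'cV[K]_n.+1 => w i 0)).
  exact: cvg_snd.
exact: coord_continuous.
Qed.

Lemma is_derive_snd_coord i (V : normedModType K) (f : V -> KK) a v :
  derivable f a v -> is_derive a v (fun x => (f x).2 i 0) (('D_v f a).2 i 0).
Proof.
move=> /(@is_derive_linear K V _ _ (snd_coord i : {linear _ -> K^o})).
by apply; exact: snd_coord_continuous.
Qed.

Lemma derive_fst (V : normedModType K) (f : V -> KK) a v :
  derivable f a v -> ('D_v f a).1 = 'D_v (fun x => (f x).1) a.
Proof.
move=> fd; have fst_c : continuous (fst : KK -> K^o).
  by move=> q; exact: cvg_fst.
by have [_ <-] :=
  @is_derive_linear K V KK _ (fst : {linear _ -> K^o}) f a v fst_c fd.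
Qed.

Lemma horizontal_line (h t : K) (y : 'cV[K]_n.+1) :
  h *: ((1, 0) : KK) + (t, y) = (h + t, y).
Proof.
by congr pair; rewrite /= ?scaler0 ?add0r //; congr (_ + _); exact: mulr1.
Qed.

Lemma vertical_line (h t : K) (y w : 'cV[K]_n.+1) :
  h *: ((0, w) : KK) + (t, y) = (t, h *: w + y).
Proof. by congr pair; rewrite /= scaler0 add0r. Qed.

End ProductComponents.

(** * The bracket at a point *)

Section Bracket.
Context {R : realType} {m r : nat}.
Local Notation C := (Cplx R).
Local Notation CP1 := (CP1 R).
Local Notation n := m.+1.
Local Notation CC := (C * 'cV[C]_n)%type.
Variables (A : 'M[CP1 -> CP1]_n) (V : set CP1) (Y : vfield R n).
Hypotheses (V_open : open V) (Y_homog : homog_poly_vfield r V Y).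
Implicit Types (y : 'cV[C]_n).

Lemma fibreE p y : V p -> Y (p, y) = (0, homog_eval (fibre r Y p) y).
Proof.
move=> Vp; have [_ /(_ p Vp) Z_ex] := Y_homog.
exact: (xgetPex 0 Z_ex y).
Qed.

Lemma in_chart_homog b t y : V (chart b t) ->
  in_chart b Y (t, y) = (0, homog_eval (fibre r Y (chart b t)) y).
Proof.
move=> Vt; rewrite /in_chart /= fibreE //=; case: b Vt => //= _.
by rewrite mulr0 if_same.
Qed.

Lemma in_chart_system b t y :
  in_chart b (system_vfield A) (t, y) =
    (speed b t, mx_at A (chart b t) *m y).
Proof.
rewrite /in_chart /system_vfield; case: b => //=.
by case: eqP => [->|_]; rewrite ?expr0n ?oppr0 ?mulr1.
Qed.

Lemma near_in_V b t : V (chart b t) -> \forall s \near t, V (chart b s).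
Proof.
move=> Vt.
exact: (@chart_continuous R b t V (open_nbhs_nbhs (conj V_open Vt))).
Qed.

Section Point.
Variables (b : chart_index) (t : C).
Hypothesis Vt : V (chart b t).
Let B := mx_at A (chart b t).
Let Z s := fibre r Y (chart b s).

Lemma in_chart_derivable y v : derivable (in_chart b Y) (t, y) v.
Proof. by apply: diff_derivable; have [Yd _] := Y_homog; exact: Yd. Qed.

Lemma is_derive_component_fibre y i :
  is_derive t (1 : C) (fun s => component_at (y, i) (Z s) : C)
    (('D_((1, 0) : CC) (in_chart b Y) (t, y)).2 i 0).
Proof.
have /(is_derive_along (g := fun s => (in_chart b Y (s, y)).2 i 0)) :=
  is_derive_snd_coord i (@in_chart_derivable y (1, 0)).
move=> /(_ t) d; apply: near_eq_is_derive (d _).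
  apply: filterS (near_in_V Vt) => s Vs.
  by rewrite in_chart_homog // component_atE.
by move=> h; rewrite horizontal_line.
Qed.

Lemma fibre_vderivable : vderivable (fibre r Y \o chart b) t.
Proof.
apply: (vderivable_separating component_at_separating) => -[y i].
by case: (is_derive_component_fibre y i).
Qed.

Lemma component_at_ddx y i : component_at (y, i) (ddx (fibre r Y) b t) =
  speed b t * ('D_((1, 0) : CC) (in_chart b Y) (t, y)).2 i 0.
Proof.
rewrite /ddx linearZ /=; congr (_ * _).
have [_ <-] := is_derive_functional (component_at (y, i)) fibre_vderivable.
by have [_ ->] := is_derive_component_fibre y i.
Qed.

Lemma derive_vertical y w i :
  ('D_((0, w) : CC) (in_chart b Y) (t, y)).2 i 0 =
  \sum_k w k 0 * meval (fun j => y j 0) (mderiv k (Z t i)).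
Proof.
pose c (h : C) k := (h *: w + y) k 0.
have cd k : is_derive (0 : C) (1 : C) (c^~ k) (w k 0).
  have -> : c^~ k = (fun h => h * w k 0 + y k 0).
    by apply: funext => h; rewrite /c !mxE.
  have := is_deriveD
    (is_deriveMf (is_derive_id (0 : C) (1 : C))
      (is_derive_cst (w k 0) (0 : C) (1 : C)))
    (is_derive_cst (y k 0) (0 : C) (1 : C)).
  by rewrite mul1r mul0r !addr0.
have [_ dZ] := is_derive_meval (Z t i) cd.
have along (h : C) : meval (c (h + 0)) (Z t i) =
    (in_chart b Y (h *: ((0, w) : CC) + (t, y))).2 i 0.
  by rewrite vertical_line in_chart_homog // mxE addr0.
have [_ dY] := is_derive_along (g := fun h => meval (c h) (Z t i)) along
  (is_derive_snd_coord i (@in_chart_derivable y (0, w))).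
rewrite -dY dZ; apply: eq_bigr => k _; congr (_ * _); apply: meval_eq => j.
by rewrite /c scale0r add0r.
Qed.

(** X is affine in y on the fibre over t, so its vertical difference quotients
    are constant, whatever the dependence of A on x. *)
Lemma derive_system y w :
  'D_((0, w) : CC) (in_chart b (system_vfield A)) (t, y) = (0, B *m w).
Proof.
apply: cvg_lim => //.
have cst_cvg : (fun h : C => (0, B *m w) : CC) @ (0 : C)^' --> ((0, B *m w) : CC).
  exact: cvg_cst.
apply: cvg_trans cst_cvg; apply: near_eq_cvg; near=> h.
have h0 : h != 0 by near: h; exact: nbhs_dnbhs_neq.
rewrite /= vertical_line !in_chart_system; congr pair; rewrite /=.
  by rewrite subrr scaler0.
by rewrite mulmxDr addrK -scalemxAr scalerA mulVf // scale1r.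
Unshelve. all: by end_near. Qed.

Lemma bracket_fst y : (bracket b Y (system_vfield A) (t, y)).1 = 0.
Proof.
have near_V : \forall q \near ((t, y) : CC), V (chart b q.1).
  have fst_cvg : fst @ ((t, y) : CC) --> t by exact: cvg_fst.
  exact: (fst_cvg _ (near_in_V Vt)).
have near0 : \forall q \near ((t, y) : CC), (in_chart b Y q).1 = cst 0 q.
  by apply: filterS near_V => -[s w] /= Vs; rewrite in_chart_homog.
rewrite /bracket in_chart_homog // derive_system /= derive_fst.
  by rewrite (near_eq_derive _ near0) derive_cst subrr.
exact: in_chart_derivable.
Qed.

(** The derivative of Y along X = (speed, B y) splits, by linearity of the
    differential, into speed times the horizontal derivative, which is dY/dx,
    and the vertical derivative along B y, which is part of Phi_r'(B) Y. *)
Lemma bracket_snd y i : (bracket b Y (system_vfield A) (t, y)).2 i 0 =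
  component_at (y, i) (rep_diff (Phi r) B (Z t)) -
  component_at (y, i) (ddx (fibre r Y) b t).
Proof.
have Yd : differentiable (in_chart b Y) (t, y).
  by have [Yd _] := Y_homog; exact: Yd.
rewrite /bracket in_chart_homog // in_chart_system derive_system.
have -> : 'D_(speed b t, B *m y) (in_chart b Y) (t, y) =
    speed b t *: 'D_((1, 0) : CC) (in_chart b Y) (t, y) +
    'D_((0, B *m y) : CC) (in_chart b Y) (t, y).
  have -> : (speed b t, B *m y) = speed b t *: ((1, 0) : CC) + (0, B *m y).
    congr pair; rewrite /= ?scaler0 ?add0r // addr0; exact/esym/mulr1.
  by rewrite !deriveE // linearD linearZ.
rewrite component_at_rep_diff component_at_ddx.
rewrite -(derive_vertical y (B *m y) i) /= !mxE.
by rewrite opprD addrA addrAC.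
Qed.

Lemma bracket_eq0 :
  (forall y, bracket b Y (system_vfield A) (t, y) = 0) <->
  ddx (fibre r Y) b t = rep_diff (Phi r) B (Z t).
Proof.
split=> [br0|eqY y].
  apply: eq_component_at => -[y i]; apply/esym/eqP.
  by rewrite -subr_eq0 -bracket_snd br0 mxE.
move: (bracket_fst y) (bracket_snd y); case: (bracket _ _ _ _) => u w /= -> w_i.
by congr pair; apply/matrixP => i j; rewrite !ord1 w_i eqY subrr mxE.
Qed.

End Point.
End Bracket.

(** * Symmetries are the solutions of the Lie-Vessiot system *)

Theorem theorem6p1 (R : realType) (n r : nat)
    (U : set (CP1 R)) (U_nonempty : U !=set0) (U_open : open U)
    (U_connected : connected U)
    (K : set (CP1 R -> CP1 R)) (K_function_field : function_field U K)
    (A : 'M[CP1 R -> CP1 R]_n.+1) (A_in_K : forall i j, K (A i j))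
    (V : set (CP1 R)) (V_open : open V) (V_sub_U : V `<=` U)
    (Y : vfield R n.+1) (Y_homog : homog_poly_vfield r V Y) :
  (sym A V Y <-> lie_vessiot_solution (Phi r) A V (fibre r Y)) /\
  (sym A V Y <-> lie_vessiot_eq (Phi r) A V (fibre r Y)).
Proof.
have symP : sym A V Y <-> lie_vessiot_eq (Phi r) A V (fibre r Y).
  split=> [[_ _ br0] b t Vt At|LV].
    by apply/(bracket_eq0 A V_open Y_homog Vt) => y; exact: br0.
  split=> [||b [t y] Vt At]; first by case: Y_homog.
    by move=> p y Vp; rewrite (fibreE Y_homog).
  exact: (proj2 (bracket_eq0 A V_open Y_homog Vt) (LV b t Vt At) y).
split=> //; rewrite symP; split=> [LV|[]//].
split=> // b t Vt.
exact: (@fibre_vderivable R n r V Y V_open Y_homog b t Vt).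
Qed.
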